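(* Let $A\in\mathbb{R}^{t\times n}$, $b\in\mathbb{R}^t$, $B\in\mathbb{R}^{m\times n}$ and $p>0$. For any $\lambda>0$, there exists a $\gamma^*\ge 0$ such that for every $\gamma>\gamma^*$ the problems $$\min\{\|Ax-b\|_0+\lambda\|Bx\|_0: x\in\mathbb{R}^n\}\quad\text{and}\quad\min\{\|Ax-b\|_0+\lambda\psi_\gamma(Bx): x\in\mathbb{R}^n\}$$ share the same optimal solution set (set of global minimizers).
   Context: $\|y\|_0$ denotes the number of nonzero entries of $y$. For $p>0$, $\gamma>0$, $\psi_\gamma(y)=\sum_{i=1}^m\varphi_\gamma(y_i)$ for $y\in\mathbb{R}^m$, where $\varphi_\gamma(t)=\min(\gamma|t|^p,1)$. *)

(* Defs.v *)
From HB Require Import structures.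
From mathcomp Require Import all_boot all_order all_algebra.
From mathcomp Require Import all_classical all_reals all_analysis.

Set Implicit Arguments.
Unset Strict Implicit.
Unset Printing Implicit Defensive.

Import Order.TTheory GRing.Theory Num.Theory.

Local Open Scope classical_set_scope.
Local Open Scope ring_scope.

Definition l0norm (R : realType) (m : nat) (y : 'cV[R]_m) : nat :=
  #|[pred i : 'I_m | y i ord0 != 0]|.

(* For p > 0, [powR] gives 0 `^ p = 0, so phi vanishes at t = 0. *)
Definition phi (R : realType) (p gamma t : R) : R :=
  Num.min (gamma * `|t| `^ p) 1.

Definition psi (R : realType) (m : nat) (p gamma : R) (y : 'cV[R]_m) : R :=
  \sum_(i < m) phi p gamma (y i ord0).

Definition argmin (R : realType) (T : Type) (f : T -> R) : set T :=
  [set x | forall y : T, f x <= f y].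

(* Main.v *)
(** Linear systems have a residual gap: there is [eps > 0] such that whatever
    equations of [M x = c] are satisfied up to [eps] by some [x] are satisfied
    exactly by some [y].  Indeed an inconsistent system has a certificate [w]
    with [w M = 0] and [w c <> 0], so its residuals cannot all be small, and
    there are finitely many subsystems.  For [gamma > 1 / eps `^ p], apply this
    to the stacked system [A x = b, B x = 0]: every [x] has a [y] which zeroes
    all the entries of [A x - b] that vanish and all the entries of [B x] with
    [phi < 1].  Hence the l0 objective at [y] is at most the relaxed objective
    at [x], with equality only if both objectives agree at [x]. *)

Require Import Defs.
From HB Require Import structures.
From mathcomp Require Import all_boot all_order all_algebra.
From mathcomp Require Import all_classical all_reals all_analysis.

Set Implicit Arguments.
Unset Strict Implicit.
Unset Printing Implicit Defensive.

Import Order.TTheory GRing.Theory Num.Theory.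

Local Open Scope classical_set_scope.
Local Open Scope ring_scope.

Lemma residual_gap (R : realFieldType) (k n : nat)
    (M : 'M[R]_(k, n)) (c : 'cV[R]_k) :
  exists2 eps : R, 0 < eps & forall x : 'cV[R]_n,
    (forall i, `|(M *m x - c) i ord0| < eps) -> exists y, M *m y = c.
Proof.
have [/submxP[D cD]|] := boolP (c^T <= M^T)%MS.
  exists 1 => // x _; exists D^T.
  by rewrite -[RHS]trmxK cD trmx_mul trmxK.
rewrite submxE => /rV0Pn[j cKj].
(* Fredholm certificate: a column of the cokernel of [M^T] that does not annihilate [c^T]. *)
pose w := (col j (cokermx M^T))^T.
have wM : w *m M = 0.
  by apply: trmx_inj; rewrite trmx_mul trmxK colE mulmxA mulmx_coker mul0mx trmx0.
have wc : (w *m c) ord0 ord0 != 0.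
  suff -> : (w *m c) ord0 ord0 = (c^T *m cokermx M^T) ord0 j by [].
  by rewrite -[w *m c]trmxK trmx_mul trmxK colE mulmxA -colE !mxE.
(* The l1 norm of [w] plus 1: residuals below [|w c| / s] would give
   [|w c| <= (s - 1) * |w c| / s < |w c|]. *)
pose s := \sum_i `|w ord0 i| + 1.
have s_gt0 : 0 < s by rewrite ltr_wpDl // sumr_ge0.
exists (`|(w *m c) ord0 ord0| / s) => [|x small].
  by rewrite divr_gt0 // normr_gt0.
exfalso; suff : `|(w *m c) ord0 ord0| < `|(w *m c) ord0 ord0| by rewrite ltxx.
have {1}-> : w *m c = - (w *m (M *m x - c)).
  by rewrite mulmxBr mulmxA wM mul0mx sub0r opprK.
rewrite mxE normrN mxE; apply: (le_lt_trans (ler_norm_sum _ _ _)).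
apply: (@le_lt_trans _ _ ((s - 1) * (`|(w *m c) ord0 ord0| / s))).
  rewrite addrK mulr_suml ler_sum // => i _.
  by rewrite normrM ler_wpM2l // ltW.
by rewrite mulrCA gtr_pMr ?normr_gt0 // ltr_pdivrMr // mul1r gtrBl.
Qed.

Lemma uniform_residual_gap (R : realFieldType) (k n : nat)
    (M : 'M[R]_(k, n)) (c : 'cV[R]_k) :
  exists2 eps : R, 0 < eps & forall x : 'cV[R]_n, exists y : 'cV[R]_n,
    forall i, `|(M *m x - c) i ord0| < eps -> (M *m y - c) i ord0 = 0.
Proof.
(* Multiplying by [D I] keeps the equations in [I] and turns the others into [0 = 0], so every
   subsystem has the same format. *)
pose D (I : {set 'I_k}) : 'M[R]_k := diag_mx (\row_i (i \in I)%:R).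
have DE I (v : 'cV[R]_k) i : (D I *m v) i ord0 = (i \in I)%:R * v i ord0.
  by rewrite mul_diag_mx !mxE.
have /choice[e eP] I : exists e : R, 0 < e /\ forall x : 'cV[R]_n,
    (forall i, `|(D I *m M *m x - D I *m c) i ord0| < e) ->
    exists y, D I *m M *m y = D I *m c.
  by have [e e_gt0 eP] := residual_gap (D I *m M) (D I *m c); exists e.
pose eps := \big[Num.min/1]_I e I.
exists eps => [|x].
  by apply: lt_bigmin => // I _; case: (eP I).
(* Only the subsystem depends on [x]; [eps] is a minimum over all of them. *)
pose I := finset (fun i => `|(M *m x - c) i ord0| < eps).
have [eI_gt0 /(_ x)[i|y yI]] := eP I.
  rewrite -mulmxA -mulmxBr DE; case: (boolP (i \in I)) => [|_].
    by rewrite finset.inE mul1r => /lt_le_trans; apply; rewrite /eps bigmin_le.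
  by rewrite mul0r normr0.
exists y => i ilt; have iI : i \in I by rewrite finset.inE.
have := DE I (M *m y - c) i.
by rewrite mulmxBr mulmxA yI subrr iI mul1r mxE => <-.
Qed.

Lemma l0normE (R : realType) (m : nat) (y : 'cV[R]_m) :
  (l0norm y)%:R = \sum_(i < m) (y i ord0 != 0)%:R :> R.
Proof.
rewrite /l0norm -sum1_card natr_sum big_mkcond /=.
by apply: eq_bigr => i _; rewrite inE; case: (y i ord0 != 0).
Qed.

Lemma phi0 (R : realType) (p gamma : R) : 0 < p -> phi p gamma 0 = 0.
Proof.
by move=> p_gt0; rewrite /phi normr0 powR0 ?gt_eqF // mulr0 min_l ?ler01.
Qed.

Lemma phi_ge0 (R : realType) (p gamma t : R) : 0 < gamma -> 0 <= phi p gamma t.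
Proof.
by move=> g_gt0; rewrite /phi le_min ler01 mulr_ge0 ?powR_ge0 // ltW.
Qed.

Lemma phi_gt0 (R : realType) (p gamma t : R) :
  0 < gamma -> t != 0 -> 0 < phi p gamma t.
Proof.
by move=> g_gt0 t0; rewrite /phi lt_min ltr01 mulr_gt0 ?powR_gt0 ?normr_gt0.
Qed.

Lemma phi_le_neq0 (R : realType) (p gamma t : R) :
  0 < p -> phi p gamma t <= (t != 0)%:R.
Proof.
move=> p_gt0; have [->|_] := eqVneq t 0; first by rewrite phi0.
by rewrite /phi ge_min lexx orbT.
Qed.

(** Contrapositive: if [eps <= |t|], then [gamma * |t| ^ p >= gamma * eps ^ p > 1], so the minimum
    is 1. *)
Lemma phi_lt1_small (R : realType) (p gamma eps t : R) :
  0 < p -> 0 < eps -> (eps `^ p)^-1 < gamma -> phi p gamma t < 1 -> `|t| < eps.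
Proof.
move=> p_gt0 e_gt0 ltg; rewrite /phi gt_min ltxx orbF; apply: contraTT.
have ep_gt0 : 0 < eps `^ p by rewrite powR_gt0.
have g_gt0 : 0 < gamma by apply: lt_trans ltg; rewrite invr_gt0.
rewrite -!leNgt => let_; apply: (@le_trans _ _ (gamma * eps `^ p)).
  by rewrite -ler_pdivrMr // mul1r ltW.
by rewrite ler_pM2l // ge0_ler_powR // ?nnegrE // ltW.
Qed.

Lemma psi_le_l0norm (R : realType) (m : nat) (p gamma : R) (y : 'cV[R]_m) :
  0 < p -> psi p gamma y <= (l0norm y)%:R.
Proof.
by move=> p_gt0; rewrite l0normE; apply: ler_sum => i _; exact: phi_le_neq0.
Qed.

(** Meant for [s] an entry of [B x] and [t] the same entry of [B y]. *)
Lemma neq0_le_phi (R : realType) (p gamma s t : R) : 0 < gamma ->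
  (phi p gamma s < 1 -> t = 0) -> (t != 0)%:R <= phi p gamma s.
Proof.
move=> g_gt0 st; have [/st->|] := ltP (phi p gamma s) 1.
  by rewrite eqxx phi_ge0.
by apply: le_trans; rewrite lern1 leq_b1.
Qed.

Lemma l0norm_le_psi (R : realType) (m : nat) (p gamma : R) (y z : 'cV[R]_m) :
  0 < gamma -> (forall i, phi p gamma (y i ord0) < 1 -> z i ord0 = 0) ->
  (l0norm z)%:R <= psi p gamma y.
Proof.
move=> g_gt0 yz; rewrite l0normE; apply: ler_sum => i _.
by apply: neq0_le_phi => //; exact: yz.
Qed.

(** The differences of corresponding terms are nonnegative and sum to 0, so each vanishes. Hence
    [phi] is 0 or 1 at every entry of [y], and at a nonzero entry it is positive, so 1. *)
Lemma psi_eq_l0norm (R : realType) (m : nat) (p gamma : R) (y z : 'cV[R]_m) :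
  0 < p -> 0 < gamma ->
  (forall i, phi p gamma (y i ord0) < 1 -> z i ord0 = 0) ->
  psi p gamma y <= (l0norm z)%:R -> psi p gamma y = (l0norm y)%:R.
Proof.
move=> p_gt0 g_gt0 yz psi_le.
have psiE : psi p gamma y = (l0norm z)%:R.
  by apply/le_anti; rewrite psi_le l0norm_le_psi.
have eq_phi i : phi p gamma (y i ord0) = (z i ord0 != 0)%:R.
  apply/eqP; rewrite -subr_eq0; apply/eqP.
  move: i isT; apply: psumr_eq0P => [i _|].
    by rewrite subr_ge0 neq0_le_phi //; exact: yz.
  by rewrite sumrB -/(psi p gamma y) psiE l0normE subrr.
rewrite l0normE; apply: eq_bigr => i _.
have [yi0|yi0] := eqVneq (y i ord0) 0; first by rewrite yi0 phi0.
by move: (phi_gt0 p g_gt0 yi0); rewrite eq_phi; case: (z i ord0 != 0); rewrite ?ltxx.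
Qed.

Lemma l0norm_le (R : realType) (t : nat) (u v : 'cV[R]_t) :
  (forall i, u i ord0 = 0 -> v i ord0 = 0) -> (l0norm v <= l0norm u)%N.
Proof.
move=> uv; apply/subset_leq_card/fintype.subsetP => i; rewrite !inE.
by apply: contraNN => /eqP/uv->.
Qed.

(** A minimizer [x] of [g] has [g x <= g z <= f z] for the point [z] attached to it, so [g x = f x],
    which is a lower bound of [f]. For a minimizer [x] of [f], [g x <= f x <= f z <= g y] with [z]
    attached to [y]. *)
Lemma argmin_relaxation (R : realType) (T : Type) (f g : T -> R) :
  (forall x, g x <= f x) ->
  (forall x, exists2 y, f y <= g x & g x <= f y -> g x = f x) ->
  argmin f = argmin g.
Proof.
move=> le_gf fg; apply/seteqP; split=> x /= xmin y.
  have [z fz _] := fg y.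
  exact: le_trans (le_gf x) (le_trans (xmin z) fz).
have [z _ gfx] := fg x.
rewrite -gfx; first exact: le_trans (xmin y) (le_gf y).
exact: le_trans (xmin z) (le_gf z).
Qed.

Theorem theorem6p7 (R : realType) (t n m : nat)
    (A : 'M[R]_(t, n)) (b : 'cV[R]_t) (B : 'M[R]_(m, n))
    (p : R) (hp : 0 < p) (lambda : R) (hlambda : 0 < lambda) :
  exists2 gamma_star : R, 0 <= gamma_star &
    forall gamma : R, gamma_star < gamma ->
      argmin (fun x : 'cV[R]_n =>
        (l0norm (A *m x - b))%:R + lambda * (l0norm (B *m x))%:R) =
      argmin (fun x : 'cV[R]_n =>
        (l0norm (A *m x - b))%:R + lambda * psi p gamma (B *m x)).
Proof.
have [eps eps_gt0 gap] := uniform_residual_gap (col_mx A B) (col_mx b 0).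
exists (eps `^ p)^-1 => [|gamma ltg]; first by rewrite invr_ge0 powR_ge0.
have g_gt0 : 0 < gamma by apply: le_lt_trans ltg; rewrite invr_ge0 powR_ge0.
apply: argmin_relaxation => x.
  by rewrite lerD2l ler_pM2l // psi_le_l0norm.
have [y yP] := gap x.
have res (z : 'cV[R]_n) : col_mx A B *m z - col_mx b 0 =
    col_mx (A *m z - b) (B *m z).
  by rewrite mul_col_mx opp_col_mx add_col_mx subr0.
have Ay i : (A *m x - b) i ord0 = 0 -> (A *m y - b) i ord0 = 0.
  move=> Ax0; have := yP (lshift m i).
  by rewrite !res !col_mxEu Ax0 normr0; apply.
have By i : phi p gamma ((B *m x) i ord0) < 1 -> (B *m y) i ord0 = 0.
  move/(phi_lt1_small hp eps_gt0 ltg).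
  by have := yP (rshift t i); rewrite !res !col_mxEd.
have leA : (l0norm (A *m y - b))%:R <= (l0norm (A *m x - b))%:R :> R.
  by rewrite ler_nat l0norm_le.
have leB := l0norm_le_psi g_gt0 By.
exists y => [|leF]; first by rewrite lerD // ler_pM2l.
(* It remains to bound [psi] at [B x] by the l0 norm of [B y]: by [leA], the residual count at [y]
   in [leF] may be replaced by the one at [x], which then cancels. *)
rewrite (psi_eq_l0norm hp g_gt0 By) // -(ler_pM2l hlambda).
by rewrite -(lerD2l (l0norm (A *m x - b))%:R) (le_trans leF) // lerD2r.
Qed.
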